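(* Let $\{F_m\}_{m\in\mathbb{R}}$ be a feasible family of functions $F_m:\mathbb{R}\to[0,1]$, and let $\mathcal{A}^m:=\{Q\in\mathcal{P}(\mathbb{R})\mid F_Q\le F_m\text{ pointwise}\}$ for $m\in\mathbb{R}$. Then the family $\{\mathcal{A}^m\}_{m\in\mathbb{R}}$ is monotone decreasing and left continuous, and each set $\mathcal{A}^m$ is convex and $\sigma(\mathcal{P},C_b)$-closed. The associated map $$\Phi(P):=-\sup\{m\in\mathbb{R}\mid P\in\mathcal{A}^m\},\qquad P\in\mathcal{P}(\mathbb{R}),$$ is well defined as a map $\Phi:\mathcal{P}(\mathbb{R})\to\mathbb{R}\cup\{+\infty\}$, and it is monotone decreasing (i.e. $P\preccurlyeq Q$ implies $\Phi(P)\ge\Phi(Q)$), quasi-convex (i.e. $\Phi(\lambda P+(1-\lambda)Q)\le\Phi(P)\vee\Phi(Q)$ for $\lambda\in[0,1]$) and $\sigma(\mathcal{P},C_b)$-lower semicontinuous.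
   Context: $\mathcal{P}=\mathcal{P}(\mathbb{R})$ is the set of Borel probability measures on $\mathbb{R}$, and $F_Q(x)=Q(-\infty,x]$. First order stochastic dominance: $Q\preccurlyeq P$ iff $F_P(x)\le F_Q(x)$ for all $x\in\mathbb{R}$. $\sigma(\mathcal{P},C_b)$ is the topology of weak convergence (against bounded continuous functions). A family $\{F_m\}_{m\in\mathbb{R}}$ of functions $F_m:\mathbb{R}\to[0,1]$ is feasible if: (a) for any $P\in\mathcal{P}$ there exists $m$ such that $P\notin\mathcal{A}^m$; (b) for every $m\in\mathbb{R}$, $x\mapsto F_m(x)$ is right continuous; (c) for every $x\in\mathbb{R}$, $m\mapsto F_m(x)$ is (weakly) decreasing and left continuous. A family of sets is monotone decreasing if $\mathcal{A}^m\subseteq\mathcal{A}^n$ whenever $m\ge n$; such a family is left continuous if $\mathcal{A}^m=\bigcap_{\varepsilon>0}\mathcal{A}^{m-\varepsilon}$ for every $m\in\mathbb{R}$. Convention: $\sup\emptyset=-\infty$. *)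

(* Defs.v *)
From HB Require Import structures.
From mathcomp Require Import all_boot all_order all_algebra.
From mathcomp Require Import all_classical all_reals all_analysis.

Set Implicit Arguments.
Unset Strict Implicit.
Unset Printing Implicit Defensive.

Import Order.TTheory GRing.Theory Num.Theory.
Import numFieldNormedType.Exports.

Local Open Scope classical_set_scope.
Local Open Scope ring_scope.

(* [measurableTypeR R] is R with its Borel sigma-algebra. A [probability] is a
   function on all sets, constrained only on the measurable ones; everything
   below depends only on its values on Borel sets. *)
Notation borel_prob R := (probability (measurableTypeR R) R).

Definition prob_cdf (R : realType) (Q : borel_prob R) (x : R) : \bar R :=
  Q `]-oo, x]%classic.

(* [fsd_le Q P]: P dominates Q, i.e. the distribution function of P is smaller *)
Definition fsd_le (R : realType) (Q P : borel_prob R) : Prop :=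
  forall x : R, (prob_cdf P x <= prob_cdf Q x)%E.

Definition mix_measure (R : realType) (l : {i01 R}) (P Q : borel_prob R) :
    {measure set (measurableTypeR R) -> \bar R} :=
  measure_add (mscale (l%:num)%:nng P) (mscale (1 - l%:num)%:nng Q).

Lemma mix_measureE (R : realType) (l : {i01 R}) (P Q : borel_prob R) A :
  mix_measure l P Q A = ((l%:num)%:E * P A + (1 - l%:num)%:E * Q A)%E.
Proof. exact: measure_addE. Qed.

Lemma mix_measure_setT (R : realType) (l : {i01 R}) (P Q : borel_prob R) :
  mix_measure l P Q setT = 1%E.
Proof.
rewrite mix_measureE !probability_setT !mule1 -EFinD.
by rewrite addrC subrK.
Qed.

Section mix.
Variables (R : realType) (l : {i01 R}) (P Q : borel_prob R).

Definition mix_fun : set (measurableTypeR R) -> \bar R := mix_measure l P Q.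

HB.instance Definition _ := Measure.on mix_fun.
HB.instance Definition _ :=
  Measure_isProbability.Build _ _ _ mix_fun (mix_measure_setT l P Q).

(* l P + (1 - l) Q *)
Definition mix : borel_prob R := mix_fun.

End mix.

Definition prob_convex (R : realType) (C : set (borel_prob R)) : Prop :=
  forall (P Q : borel_prob R) (l : {i01 R}), C P -> C Q -> C (mix l P Q).

Definition Cb (R : realType) : Type :=
  {f : R -> R | continuous f /\ bounded_fun (f : R -> R^o)}.

Definition Cb_int (R : realType) (f : Cb R) (P : borel_prob R) : R :=
  \int[P]_x (sval f x).

(* sigma(P, C_b): the coarsest topology making P |-> \int f dP continuous for
   every bounded continuous f *)
Definition weak_prob (R : realType) : topologicalType :=
  sup_topology (fun f : Cb R => Topological.on (initial_topology (Cb_int f))).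

Definition accept (R : realType) (F : R -> R -> R) (m : R) :
    set (borel_prob R) :=
  [set Q | forall x : R, (prob_cdf Q x <= (F m x)%:E)%E].

Definition feasible (R : realType) (F : R -> R -> R) : Prop :=
  [/\ forall P : borel_prob R, exists m : R, ~ accept F m P,
      forall m : R, right_continuous (F m),
      forall x : R, nonincreasing_fun (F ^~ x) &
      forall x m : R, F n x @[n --> m^'-] --> F m x].

Definition monotone_decreasing (R : realType) (T : Type) (A : R -> set T) :
    Prop :=
  forall m n : R, n <= m -> A m `<=` A n.

Definition left_continuous_family (R : realType) (T : Type) (A : R -> set T) :
    Prop :=
  forall m : R, A m = \bigcap_(e in [set e : R | 0 < e]) A (m - e).

(* [ereal_sup set0 = -oo] *)
Definition Phi (R : realType) (F : R -> R -> R) (P : borel_prob R) : \bar R :=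
  (- ereal_sup [set m%:E | m in [set m : R | accept F m P]])%E.

(* Main.v *)
(* For x < y a ramp from 1 at x down to 0 at y has integral between F_P(x) and
   F_P(y); by right continuity of F_m, the constraint F_P <= F_m is therefore
   equivalent to a family of constraints on integrals of ramps, and A^m is
   weakly closed. Left continuity of the family A makes the supremum in Phi
   attained, so Phi(P) <= a iff P is in A^(-a): the sublevel sets of Phi are the
   sets A^m, from which they inherit monotonicity, convexity and closedness. *)
Require Import Defs.
From HB Require Import structures.
From mathcomp Require Import all_boot all_order all_algebra.
From mathcomp Require Import all_classical all_reals all_analysis.
From mathcomp Require Import measurable_realfun.

Set Implicit Arguments.
Unset Strict Implicit.
Unset Printing Implicit Defensive.

Import Order.TTheory GRing.Theory Num.Theory.
Import numFieldNormedType.Exports.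

Local Open Scope classical_set_scope.
Local Open Scope ring_scope.

Section ramp.
Variables (R : realType) (x y : R).

Definition ramp_fun (z : R) : R :=
  Num.max 0 (Num.min 1 ((y - z) / (y - x))).

Lemma ramp_fun_ge0 z : 0 <= ramp_fun z.
Proof. by rewrite /ramp_fun le_max lexx. Qed.

Lemma ramp_fun_le1 z : ramp_fun z <= 1.
Proof. by rewrite /ramp_fun ge_max ler01 ge_min lexx. Qed.

Lemma ramp_fun_left z : x < y -> z <= x -> ramp_fun z = 1.
Proof.
move=> xy zx; have h : 1 <= (y - z) / (y - x).
  by rewrite ler_pdivlMr ?subr_gt0// mul1r lerB.
by rewrite /ramp_fun (min_idPl h) (max_idPr ler01).
Qed.

Lemma ramp_fun_right z : x < y -> y <= z -> ramp_fun z = 0.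
Proof.
move=> xy yz; apply/max_idPl; rewrite ge_min; apply/orP; right.
by rewrite pmulr_lle0 ?invr_gt0 ?subr_gt0// subr_le0.
Qed.

Lemma continuous_ramp_fun : continuous ramp_fun.
Proof.
have lin : continuous (fun z : R => (y - z) / (y - x)).
  by move=> z; apply: cvgMl; apply: cvgB; [exact: cvg_cst|exact: cvg_id].
have minc : continuous (fun z : R => Num.min 1 ((y - z) / (y - x))).
  move=> z; have := cvg_comp2 (cvg_cst (1 : R)) (lin z).
  by apply; exact: (@min_continuous _ R (1, (y - z) / (y - x))).
move=> z; have := cvg_comp2 (cvg_cst (0 : R)) (minc z).
by apply; exact: (@max_continuous _ R (0, Num.min 1 ((y - z) / (y - x)))).
Qed.

Lemma bounded_ramp_fun : bounded_fun (ramp_fun : R -> R^o).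
Proof.
exists 1; split; first exact: num_real.
move=> M M1 z _ /=; rewrite ger0_norm ?ramp_fun_ge0//.
exact: le_trans (ramp_fun_le1 z) (ltW M1).
Qed.

Definition ramp : Cb R :=
  exist _ ramp_fun (conj continuous_ramp_fun bounded_ramp_fun).

End ramp.

Section weak_topology.
Variable R : realType.
Implicit Types (P : borel_prob R) (f : Cb R).

Lemma measurable_Cb f : measurable_fun setT (sval f : measurableTypeR R -> R).
Proof. by case: f => f [fc fb]; exact: continuous_measurable_fun. Qed.

(** A real-valued integral is the [fine] part of the extended one, which sends infinite values to 0.
    A bounded continuous function is integrable for a probability, so nothing is lost and real
    integrals can be compared through extended ones. *)
Lemma EFin_Cb_int f P : (Cb_int f P)%:E = (\int[P]_x (sval f x)%:E)%E.
Proof.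
rewrite /Cb_int /Rintegral fineK//; apply: integrable_fin_num => //.
apply: measurable_bounded_integrable => //.
- by apply: le_lt_trans (probability_le1 P measurableT) _; rewrite ltry.
- exact: measurable_Cb.
- by case: f => f [].
Qed.

Lemma continuous_Cb_int f : continuous (Cb_int f : weak_prob R -> R).
Proof.
move=> P A /(@initial_continuous _ _ (Cb_int f)) nA.
(* The neighbourhood filter of [P] converges to [P] in the supremum topology, hence in each initial
   topology: neighbourhoods for [Cb_int f] alone are already weak neighbourhoods. *)
have nbhs_le := (cvg_sup _ _ (@nbhs_filter (weak_prob R) P)).1 (@cvg_id _ _) f.
exact: nbhs_le nA.
Qed.

Lemma closed_Cb_int_le f (r : R) :
  closed ([set P | Cb_int f P <= r] : set (weak_prob R)).
Proof.
apply: (@preimage_closed (weak_prob R) R (Cb_int f) [set s | s <= r]).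
  by move=> P _; exact: continuous_Cb_int.
exact: closed_le.
Qed.

(** The ramp equals 1 up to [x] and is nonnegative elsewhere, so it dominates the indicator of the
    half-line ending at [x]. *)
Lemma prob_cdf_le_ramp P x y :
  x < y -> (prob_cdf P x <= (Cb_int (ramp x y) P)%:E)%E.
Proof.
move=> xy; rewrite EFin_Cb_int /prob_cdf -[X in P X]setIT -integral_indic//.
apply: ge0_le_integral => //.
- exact/measurable_EFinP.
- by apply/measurable_EFinP; exact: (measurable_Cb (ramp x y)).
move=> z _ /=; rewrite lee_fin indicE.
have [|_] := boolP (z \in _); last exact: ramp_fun_ge0.
by rewrite inE/= in_itv/= => zx; rewrite ramp_fun_left.
Qed.

(** The ramp vanishes from [y] on and is at most 1 before, so the indicator of the half-line ending
    at [y] dominates it. *)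
Lemma ramp_le_prob_cdf P x y :
  x < y -> ((Cb_int (ramp x y) P)%:E <= prob_cdf P y)%E.
Proof.
move=> xy; rewrite EFin_Cb_int /prob_cdf -[X in P X]setIT -integral_indic//.
apply: ge0_le_integral => //.
- by move=> z _; rewrite lee_fin ramp_fun_ge0.
- by apply/measurable_EFinP; exact: (measurable_Cb (ramp x y)).
- exact/measurable_EFinP.
move=> z _ /=; rewrite lee_fin indicE.
have [_|] := boolP (z \in _); first exact: ramp_fun_le1.
rewrite notin_setE/= in_itv/= => /negP; rewrite -ltNge => /ltW yz.
by rewrite ramp_fun_right.
Qed.

End weak_topology.

Section accept.
Variables (R : realType) (F : R -> R -> R).
Implicit Types (P Q : borel_prob R).

Lemma prob_cdf_fin_num P x : prob_cdf P x \is a fin_num.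
Proof. exact: fin_num_measure. Qed.

Lemma accept_monotone :
  (forall x, nonincreasing_fun (F ^~ x)) -> monotone_decreasing (accept F).
Proof.
move=> Fdec m n nm P Pm x; apply: le_trans (Pm x) _.
by rewrite lee_fin; exact: Fdec.
Qed.

Lemma accept_left_continuous :
  (forall x, nonincreasing_fun (F ^~ x)) ->
  (forall x m, F n x @[n --> m^'-] --> F m x) ->
  left_continuous_family (accept F).
Proof.
move=> Fdec Flc m; apply/seteqP; split=> [P Pm e /= e0|P Pm x].
  by apply: accept_monotone Pm => //; rewrite gerBl ltW.
rewrite -(fineK (prob_cdf_fin_num P x)) lee_fin.
(* For [n < m], membership at [e = m - n] bounds the distribution function at [x] by [F n x]; then
   [n] increases to [m]. *)
apply: cvgr_to_ge (Flc x m) _; near=> n.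
rewrite -lee_fin fineK ?prob_cdf_fin_num//.
have nm : 0 < m - n by rewrite subr_gt0.
by have := Pm _ nm x; rewrite subKr.
Unshelve. all: by end_near. Qed.

Lemma accept_convex m : prob_convex (accept F m).
Proof.
move=> P Q l Pm Qm x.
have -> : prob_cdf (mix l P Q) x =
    ((l%:num)%:E * prob_cdf P x + (1 - l%:num)%:E * prob_cdf Q x)%E.
  exact: mix_measureE.
have l0 : 0 <= l%:num by [].
have l1 : 0 <= 1 - l%:num by rewrite subr_ge0.
(* Splitting the bound with the same weights reduces the inequality to one comparison per term. *)
have -> : (F m x)%:E =
    ((l%:num)%:E * (F m x)%:E + (1 - l%:num)%:E * (F m x)%:E)%E.
  by rewrite -!EFinM -EFinD -mulrDl addrC subrK mul1r.
by apply: leeD; apply: lee_wpmul2l => //; rewrite lee_fin.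
Qed.

(** The bound is taken at the right end [p.2]: there it follows from the constraint at that point,
    and it gives back the constraint at [p.1] when [p.2] decreases to [p.1]. *)
Lemma accept_ramp m : right_continuous (F m) ->
  accept F m = \bigcap_(p in [set p : R * R | p.1 < p.2])
    [set P | Cb_int (ramp p.1 p.2) P <= F m p.2].
Proof.
move=> Frc; apply/seteqP; split=> [P Pm [x y] /= xy|P Pm x].
  by rewrite -lee_fin; apply: le_trans (ramp_le_prob_cdf P xy) (Pm y).
rewrite -(fineK (prob_cdf_fin_num P x)) lee_fin.
apply: cvgr_to_ge (Frc x) _; near=> y.
have xy : x < y by [].
apply: le_trans (Pm (x, y) xy).
by rewrite -lee_fin fineK ?prob_cdf_fin_num// prob_cdf_le_ramp.
Unshelve. all: by end_near. Qed.

Lemma accept_closed m : right_continuous (F m) ->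
  closed (accept F m : set (weak_prob R)).
Proof.
move=> /accept_ramp ->.
by apply: (@closed_bigI (weak_prob R)) => p _; exact: closed_Cb_int_le.
Qed.

Lemma Phi_le P a :
  monotone_decreasing (accept F) -> left_continuous_family (accept F) ->
  (Phi F P <= a%:E)%E <-> accept F (- a) P.
Proof.
move=> Adec Alc; rewrite /Phi leeNl -EFinN; split=> [aP|Pa]; last first.
  by apply: ereal_sup_ubound; exists (- a).
(* It suffices to accept [P] at each level [- a - e]. That level lies strictly below the supremum,
   hence below some accepted [m], and the family is decreasing. *)
rewrite Alc => e /= e0.
have /ereal_sup_gt[_ [m Pm <-]] : ((- a - e)%:E <
    ereal_sup [set m%:E | m in [set m : R | accept F m P]])%E.
  by apply: lt_le_trans aP; rewrite lte_fin gtrBl.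
by rewrite lte_fin => /ltW /Adec; apply.
Qed.

End accept.

Theorem proposition12 (R : realType) (F : R -> R -> R)
    (F01 : forall m x : R, 0 <= F m x <= 1) (feasF : feasible F) :
  [/\ monotone_decreasing (accept F),
      left_continuous_family (accept F),
      forall m : R, prob_convex (accept F m) &
      forall m : R, closed (accept F m : set (weak_prob R))] /\
  [/\ forall P : borel_prob R, (-oo < Phi F P)%E,
      forall P Q : borel_prob R, fsd_le P Q -> (Phi F Q <= Phi F P)%E,
      forall (P Q : borel_prob R) (l : {i01 R}),
        (Phi F (mix l P Q) <= Order.max (Phi F P) (Phi F Q))%E &
      lower_semicontinuous (Phi F : weak_prob R -> \bar R)].
Proof.
case: feasF => Fne Frc Fdec Flc.
have Adec := accept_monotone Fdec.
have Alc := accept_left_continuous Fdec Flc.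
have PhiP P a := Phi_le P a Adec Alc.
have PhiNy P : (-oo < Phi F P)%E.
  have [m Pm] := Fne P.
  (* [P] is rejected at [m], which forces its value under [Phi F] above [- m]. *)
  apply: (@lt_trans _ _ (- m)%:E); first exact: ltNyr.
  by rewrite ltNge; apply/negP => /PhiP; rewrite opprK.
split; split=> //.
- exact: accept_convex.
- by move=> m; exact: accept_closed.
- move=> P Q PQ; case: (Phi F P) (PhiNy P) (PhiP P) => [a _ PhiPa|_ _|//].
    apply/PhiP => x; apply: le_trans (PQ x) _.
    by have /PhiPa := lexx a%:E; apply.
  exact: leey.
(* If the maximum is a real [a], both [P] and [Q] are accepted at [- a], and convexity applies; the
   value [-oo] is excluded by [PhiNy]. *)
- move=> P Q l; case E : (Order.max _ _) => [a||]; last 2 first.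
  + exact: leey.
  + by have := PhiNy P; rewrite ltNge -E le_max lexx.
  have : (Order.max (Phi F P) (Phi F Q) <= a%:E)%E by rewrite E.
  rewrite ge_max => /andP[/PhiP Pa /PhiP Qa].
  by apply/PhiP; exact: accept_convex.
(* Strict superlevel sets at real [a] must be open; their complements are the closed sets
   [accept F (- a)]. *)
- apply/lower_semicontinuousP => a; rewrite -closedC.
  rewrite (_ : ~` _ = accept F (- a)); first exact: accept_closed.
  apply/seteqP; split=> P /=.
    by move=> /negP; rewrite -leNgt => /PhiP.
  by move=> /PhiP Pa /=; apply/negP; rewrite -leNgt.
Qed.
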